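(* Let $\theta>0$ and let $X_1,\dots,X_n$ be independent real random variables with $X_i\sim\operatorname{subW}(\theta,v_i)$, i.e. $v_i=\|X_i\|_{\varphi_\theta}<\infty$, for $i=1,\dots,n$. Let $\bar v=\frac1n\sum_{i=1}^n v_i$ and $C_\theta:=\max_{k\ge1}\left(\frac{2\sqrt{2\pi}}{\theta}\right)^{1/k}\left(\frac k\theta\right)^{1/(2k)}$. Then: (1) for all $t\ge e\left(\sum_{i=1}^nv_i\right)C_\theta\,(2^{-1}\theta e^{11/12})^{-1/\theta}$, $$\mathrm{P}\Big(\Big|\sum_{i=1}^nX_i\Big|\ge t\Big)\le\exp\left\{-\frac{\theta e^{11/12}t^\theta}{2\left[e\left(\sum_{i=1}^nv_i\right)C_\theta\right]^\theta}\right\};$$ (2) for all $\alpha>0$ with $1-\alpha\in(1-e^{-1},1]$, $$\mathrm{P}\left(\Big|\frac1n\sum_{i=1}^nX_i\Big|\le e\,\bar v\,2^{1/\theta}C_\theta\left(\frac{\log(\alpha^{-1})}{\theta e^{11/12}}\right)^{1/\theta}\right)\ge1-\alpha;$$ (3) for all $t>0$, $$\mathrm{P}\left(\Big|\sum_{i=1}^nX_i\Big|\ge e\Big(\sum_{i=1}^n(\mathrm{E}|X_i|)^t\Big)^{1/t}+e\Big(\sum_{i=1}^nv_i\Big)2^{1/\theta}C_\theta\Big(\frac{t}{\theta e^{11/12}}\Big)^{1/\theta}\right)\le e^{-t}.$$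
   Context: For $\theta>0$, $\|X\|_{\varphi_\theta}:=\sup_{k\ge1}\left(\mathrm{E}|X|^{\theta k}/k!\right)^{1/(\theta k)}$ (supremum over positive integers $k$). One writes $X\sim\operatorname{subW}(\theta,v)$ if $v=\|X\|_{\varphi_\theta}<\infty$.
   Formalization: Part (3) is stated under the extra assumption that the sum of the v_i is positive; if all v_i = 0 then every X_i vanishes almost surely, the threshold is 0, and the probability is 1 > e^{-t}, so (3) fails. *)

(* Defs.v *)
From mathcomp Require Import all_boot all_order all_algebra.
From mathcomp Require Import all_classical all_reals all_analysis.

Set Implicit Arguments.
Unset Strict Implicit.
Unset Printing Implicit Defensive.

Import Order.TTheory GRing.Theory Num.Theory.

Local Open Scope classical_set_scope.
Local Open Scope ring_scope.

Section defs.
Context {d : measure_display} {T : measurableType d} {R : realType}.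
Variable P : probability T R.

(* Mutual independence of the whole family: the product rule is required on
   every subfamily J and all Borel sets (B i), i in J. *)
Definition mutually_independent (I : finType) (X : I -> {RV P >-> R}) : Prop :=
  forall (J : {set I}) (B : I -> set R),
    (forall i, i \in J -> measurable (B i)) ->
    P (\bigcap_(i in [set` J]) (X i @^-1` B i)) =
    (\prod_(i in J) P (X i @^-1` B i))%E.

(* Extended-real valued: the norm is +oo as soon as one of the moments
   E|X|^(theta k) is infinite or the supremum diverges. *)
Definition subW_norm (theta : R) (X : {RV P >-> R}) : \bar R :=
  ereal_sup [set (poweR ('E_P[fun w => (`|X w| `^ (theta * k%:R))%R]
                           * ((k`!)%:R^-1)%:E)
                        ((theta * k%:R)^-1)%R)%E
            | k in [set k : nat | (1 <= k)%N]].

(* v is a real number, so the equality contains the finiteness of the norm. *)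
Definition subW (theta v : R) (X : {RV P >-> R}) : Prop :=
  subW_norm theta X = v%:E.

End defs.

(* The maximum is rendered by [sup], k ranging over the positive integers: the
   terms tend to 1 and are > 1 for all large k, so that the set is bounded
   and its supremum is attained (here 0 < theta). *)
Definition Ctheta {R : realType} (theta : R) : R :=
  sup [set ((2 * Num.sqrt (2 * pi)) / theta) `^ (k%:R^-1)
           * (k%:R / theta) `^ ((2 * k%:R)^-1)
      | k in [set k : nat | (1 <= k)%N]].

(* Main.v *)
Require Import Defs.
From mathcomp Require Import all_boot all_order all_algebra.
From mathcomp Require Import all_classical all_reals all_analysis.
From mathcomp Require Import measurable_realfun ring lra.

Set Implicit Arguments.
Unset Strict Implicit.
Unset Printing Implicit Defensive.

Import Order.TTheory GRing.Theory Num.Theory.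

Local Open Scope classical_set_scope.
Local Open Scope ring_scope.

(* Write S for the sum of the X_i and V for the sum of the v_i. Minkowski's
   inequality and the definition of v_i give ||S||_q <= (k!)^(1/q) V
   whenever q = theta k >= 1, so by Markov's inequality P(|S| >= s) <= k!
   (V/s)^(theta k). All three parts reduce to P(|S| >= s) <= exp(-p) for p
   >= 1 and s = e V C (2 p / (theta e^(11/12)))^(1/theta), i.e. to finding
   k with k! e^p <= (e^theta C^theta (2 / e^(11/12)) x)^k, where x =
   p/theta. As 2 / e^(11/12) >= 3/4, for x >= 3 one takes k - 1 <= x < k
   and uses C >= 1 and k! <= (3/4 (k - 1))^k. For x < 3 one takes k = 3;
   there C^2 theta^3 >= 16 helps for theta <= 2, and e^theta for theta >=
   2. In part (3) with t <= 1, Markov's inequality for the first moment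
   suffices. *)

(** * Elementary bounds on exponentials and factorials *)

Lemma expR_le_inv1B (R : realType) (w : R) : w < 1 -> expR w <= (1 - w)^-1.
Proof.
move=> w1; rewrite -[w in leLHS]opprK expRN lef_pV2 ?posrE ?expR_gt0
  ?subr_gt0//.
exact: expR_ge1Dx.
Qed.

(** Eleventh power of [expR (1/12) <= 12/11]. It turns the factor [2 / expR (11/12)] into the
    rational lower bound 3/4. *)
Lemma expR_11_12_le (R : realType) : expR (11 / 12) <= 8 / 3 :> R.
Proof.
have -> : expR (11 / 12 : R) = expR (12^-1) ^+ 11.
  by rewrite -expRM_natl; congr expR; field.
apply: (@le_trans _ _ ((12 / 11) ^+ 11)); last by lra.
rewrite lerXn2r ?nnegrE ?expR_ge0//.
rewrite (le_trans (expR_le_inv1B _))//; first by lra.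
by rewrite [leLHS](_ : _ = 12 / 11)//; field.
Qed.

Lemma expR1_ge (R : realType) : 259 / 100 <= expR 1 :> R.
Proof.
rewrite -[X in expR X](_ : 10%:R * 10^-1 = 1 :> R); last by field.
rewrite expRM_natl.
apply: (@le_trans _ _ ((11 / 10) ^+ 10)); first by lra.
rewrite lerXn2r ?nnegrE ?expR_ge0//.
by rewrite (le_trans _ (expR_ge1Dx _))//; lra.
Qed.

(** After division by [expR (1/3)] it remains that [1 / (4/3 - u) <= 3 * u], that is
    [(3 * u - 1) * (1 - u) >= 0]. *)
Lemma expR_le_third (R : realType) (u : R) : 1 / 3 <= u -> u <= 1 ->
  expR u <= 3 * u * expR (1 / 3).
Proof.
move=> u13 u1.
have -> : u = (u - 1 / 3) + 1 / 3 by rewrite subrK.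
rewrite expRD subrK ler_wpM2r ?expR_ge0//.
apply: (le_trans (expR_le_inv1B _)); first by lra.
by rewrite -[leLHS]mul1r ler_pdivrMr; nra.
Qed.

(** Monotonicity of [expR t / t] on [1, +oo): [expR (t - u) >= 1 + t - u], and
    [u * (1 + t - u) - t = (u - 1) * (t - u)]. *)
Lemma expR_mul_le (R : realType) (u t : R) : 1 <= u -> u <= t ->
  t * expR u <= u * expR t.
Proof.
move=> u1 ut; have -> : t = (t - u) + u by rewrite subrK.
rewrite expRD subrK mulrA ler_wpM2r ?expR_ge0//.
have := expR_ge1Dx (t - u); nra.
Qed.

(** The left side consists of the two leading terms of the binomial expansion. *)
Lemma exprD1_ge (R : realType) (x : R) (n : nat) : 0 <= x ->
  x ^+ n.+1 + n.+1%:R * x ^+ n <= (x + 1) ^+ n.+1.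
Proof.
move=> x0; elim: n => [|n IH]; first by rewrite !expr1 expr0 mulr1.
rewrite [leRHS]exprS (le_trans _ (ler_wpM2l _ IH)) ?addr_ge0//.
have -> : n.+2%:R = n.+1%:R + 1 :> R by rewrite natr1.
rewrite -subr_ge0 !exprS.
rewrite [leRHS](_ : _ = n.+1%:R * x ^+ n); last by ring.
by rewrite mulr_ge0// exprn_ge0.
Qed.

(** The shift by 4 is forced: n! <= (3/4 (n - 1))^n fails at n = 3. For the induction step, put x =
    n - 1; then (1 + 1/x)^n >= 2 by the binomial bound, and x + 2 <= 3/2 (x + 1). *)
Lemma fact_le_exp (R : realType) (k : nat) :
  ((k.+4)`!)%:R <= (3 / 4 * (k.+3)%:R) ^+ k.+4 :> R.
Proof.
elim: k => [|k IH].
  by rewrite (_ : factorial 4 = 24%N)//; lra.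
have x3 : 3 <= k.+3%:R :> R by rewrite ler_nat.
have bern := @exprD1_ge R k.+3%:R k.+3 (ler0n _ _).
have E4 : (k.+4)%:R = k.+3%:R + 1 :> R by rewrite -natr1.
have E5 : (k.+4.+1)%:R = k.+3%:R + 2 :> R by rewrite -natr1 E4; ring.
rewrite factS natrM E5 E4 [leRHS]exprS; rewrite E4 in bern.
move: IH bern x3; move: (k.+3%:R : R) => x IH bern x3; move: IH.
have x0 : 0 <= x by lra.
have {}bern : 2 * x ^+ k.+4 <= (x + 1) ^+ k.+4.
  apply: le_trans bern; rewrite exprS.
  by have := exprn_ge0 k.+3 x0; nra.
have c0 : 0 <= (3 / 4) ^+ k.+4 :> R by rewrite exprn_ge0//; lra.
rewrite ![(3 / 4 * _) ^+ _]exprMn.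
set f := _%:R; move: c0; set c := (3 / 4) ^+ _; set z := (x + 1) ^+ _ => c0 IH.
have f0 : 0 <= f by rewrite ler0n.
have : f <= c * (z / 2).
  by apply: (le_trans IH); rewrite ler_wpM2l// ler_pdivlMr// mulrC.
have -> : 3 / 4 * (x + 1) * (c * z) = 3 / 2 * (x + 1) * (c * (z / 2)) by field.
nra.
Qed.

(** * Choice of the order of the moment *)

(** This is the case p = 1 of the estimate wanted for k = 3. The bound [1 / 3 <= theta] is what p >=
    1 and p < 3 theta leave. *)
Lemma expR_powR_ge (R : realType) (theta C : R) :
  1 / 3 <= theta -> 1 <= C -> (theta <= 2 -> 16 <= C ^+ 2 * theta ^+ 3) ->
  6 * expR 1 * theta ^+ 3 <= (3 / 4 * (expR theta * C `^ theta)) ^+ 3.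
Proof.
move=> t3 C1 hC.
have e1 := expR1_ge R.
have t0 : 0 <= theta by lra.
have t03 : 0 <= theta ^+ 3 by rewrite exprn_ge0.
have D1 : 1 <= C `^ theta by rewrite -(powRr0 C) ler_powR.
have tE : expR theta = expR (theta - 1) * expR 1 by rewrite -expRD subrK.
have et : theta * expR 1 <= expR theta.
  by rewrite tE ler_wpM2r ?expR_ge0// (le_trans _ (expR_ge1Dx _))//; lra.
(* If theta <= 1, then C >= 4 and 3 theta >= 1, so C^(3 theta) >= C. If 1 < theta <= 2, then C^2 >=
   2, so C >= 7/5, whose cube exceeds 27/10. *)
have D3 : theta <= 2 -> 27 / 10 <= (C `^ theta) ^+ 3.
  move=> t2; have {}hC := hC t2.
  have [t1|t1] := leP theta 1.
    have C4 : 4 <= C by have : theta ^+ 3 <= 1 by [rewrite exprn_ile1]; nra.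
    rewrite -powR_mulrn ?powR_ge0// -powRrM.
    apply: (@le_trans _ _ (C `^ 1)); last by rewrite ler_powR//; lra.
    by rewrite powRr1; lra.
  have C14 : 7 / 5 <= C.
    have : theta ^+ 3 <= 2 ^+ 3 by rewrite lerXn2r ?nnegrE.
    nra.
  have CD : C <= C `^ theta by rewrite -[leLHS]powRr1 ?ler_powR//; lra.
  apply: (@le_trans _ _ ((7 / 5) ^+ 3)); first by lra.
  by rewrite lerXn2r ?nnegrE ?powR_ge0//; lra.
have e0 : 0 <= expR 1 :> R by rewrite expR_ge0.
have e30 : 0 <= expR 1 ^+ 3 :> R by rewrite exprn_ge0.
rewrite exprMn [(expR _ * _) ^+ 3]exprMn.
have [t2|t2] := leP theta 2.
  have H : theta ^+ 3 * expR 1 ^+ 3 <= expR theta ^+ 3.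
    by rewrite -exprMn lerXn2r ?nnegrE ?mulr_ge0 ?expR_ge0.
  apply: (@le_trans _ _
    ((3 / 4) ^+ 3 * (theta ^+ 3 * expR 1 ^+ 3 * (27 / 10)))).
    rewrite [leRHS](_ : _ = (27 / 64 * (27 / 10) * expR 1 ^+ 3) * theta ^+ 3);
      last by field.
    rewrite ler_wpM2r//; nra.
  apply: ler_wpM2l; first by lra.
  by apply: ler_pM; [rewrite mulr_ge0|lra|exact: H|exact: D3].
(* For theta > 2 only C^theta >= 1 is used. The exponential alone suffices: what remains is e^5 >= 6
   * 512 / 27, a number just below 114. *)
have H : theta / 2 * expR 2 <= expR theta.
  have -> : expR theta = expR (theta - 2) * expR 2 by rewrite -expRD subrK.
  rewrite ler_wpM2r ?expR_ge0//.
  by have := expR_ge1Dx (theta - 2); lra.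
have E2 : expR 2 = expR 1 ^+ 2 :> R by rewrite -expRM_natl; congr expR; lra.
have e5 : 114 <= expR 1 ^+ 5 :> R.
  apply: (@le_trans _ _ ((259 / 100) ^+ 5)); first by lra.
  by rewrite lerXn2r ?nnegrE//; lra.
apply: (@le_trans _ _ ((3 / 4) ^+ 3 * ((theta / 2 * expR 2) ^+ 3 * 1))).
  rewrite E2 [leRHS](_ : _ = 27 / 512 * expR 1 ^+ 5 * expR 1 * theta ^+ 3);
    last by field.
  by rewrite ler_wpM2r// ler_wpM2r//; lra.
apply: ler_wpM2l; first by lra.
have th0 : 0 <= theta / 2 * expR 2 by rewrite mulr_ge0 ?expR_ge0//; lra.
apply: ler_pM; [by rewrite exprn_ge0|lra| |by rewrite exprn_ege1].
by rewrite lerXn2r ?nnegrE ?expR_ge0.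
Qed.

(** The last hypothesis is the conclusion at p = 1. For p <= 3 the inequality e^p <= p^3 e carries
    it over to p. For p > 3, p/3 lies between 1 and theta, so theta e^(p/3) <= (p/3) e^theta, and 6
    <= (9/4)^3 absorbs the factorial. *)
Lemma exp_fact_le_moment3 (R : realType) (theta D p : R) :
  1 / 3 <= theta -> 1 <= D -> 1 <= p -> p <= 3 * theta ->
  6 * expR 1 * theta ^+ 3 <= (3 / 4 * (expR theta * D)) ^+ 3 ->
  6 * expR p <= (3 / 4 * (expR theta * D) * (p / theta)) ^+ 3.
Proof.
move=> t3 D1 p1 pt h.
have t0 : 0 < theta by lra.
rewrite mulrA expr_div_n.
set W := 3 / 4 * (expR theta * D) in h *.
have -> : expR p = expR (p / 3) ^+ 3 by rewrite -expRM_natl; congr expR; field.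
rewrite ler_pdivlMr ?exprn_gt0//.
have [p3|p3] := leP p 3.
  have E : expR (p / 3) ^+ 3 <= p ^+ 3 * expR 1.
    have -> : expR 1 = expR (1 / 3) ^+ 3 :> R.
      by rewrite -expRM_natl; congr expR; field.
    rewrite -exprMn lerXn2r ?nnegrE ?expR_ge0 ?mulr_ge0 ?expR_ge0//;
      first by lra.
    have := @expR_le_third R (p / 3); rewrite [3 * _](_ : _ = p); last by field.
    by apply; lra.
  apply: (@le_trans _ _ (6 * (p ^+ 3 * expR 1) * theta ^+ 3)).
    by rewrite ler_wpM2r ?exprn_ge0 ?ler_wpM2l//; lra.
  rewrite [leLHS](_ : _ = 6 * expR 1 * theta ^+ 3 * p ^+ 3); last by ring.
  by rewrite exprMn ler_wpM2r// exprn_ge0//; lra.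
have E : theta * expR (p / 3) <= p / 3 * expR theta.
  by apply: expR_mul_le; lra.
rewrite -mulrA -exprMn.
rewrite (le_trans (y := 6 * (p / 3 * expR theta) ^+ 3))//.
  rewrite ler_wpM2l// mulrC lerXn2r ?nnegrE ?mulr_ge0 ?expR_ge0//; lra.
rewrite (_ : W * p = 9 / 4 * D * (p / 3 * expR theta));
  last by rewrite /W; field.
rewrite [leRHS]exprMn ler_wpM2r ?exprn_ge0 ?mulr_ge0 ?expR_ge0//; first by lra.
apply: (@le_trans _ _ ((9 / 4) ^+ 3)); first by lra.
by rewrite lerXn2r ?nnegrE ?mulr_ge0//; lra.
Qed.

Lemma exists_moment (R : realType) (theta C p : R) :
  0 < theta -> 1 <= C -> (theta <= 2 -> 16 <= C ^+ 2 * theta ^+ 3) -> 1 <= p ->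
  exists k, [/\ (0 < k)%N, 1 <= theta * k%:R &
    k`!%:R * expR p <=
      (expR theta * C `^ theta * (2 * p / (theta * expR (11 / 12)))) ^+ k].
Proof.
move=> t0 C1 hC p1.
have D1 : 1 <= C `^ theta by rewrite -(powRr0 C) ler_powR// ltW.
have bE : 3 / 4 * (p / theta) <= 2 * p / (theta * expR (11 / 12)).
  rewrite [leRHS](_ : _ = 2 / expR (11 / 12) * (p / theta)); last first.
    by field; rewrite !gt_eqF ?expR_gt0.
  rewrite ler_wpM2r ?divr_ge0//; [lra|lra|].
  by rewrite ler_pdivlMr ?expR_gt0//; have := expR_11_12_le R; lra.
have g0 : 0 <= expR theta * C `^ theta by rewrite mulr_ge0 ?expR_ge0 ?powR_ge0.
have x0 : 0 < p / theta by rewrite divr_gt0//; lra.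
suff [k [k0 tk H]] : exists k, [/\ (0 < k)%N, 1 <= theta * k%:R &
    k`!%:R * expR p <= (3 / 4 * (expR theta * C `^ theta) * (p / theta)) ^+ k].
  exists k; split=> //; apply: (le_trans H).
  have l0 : 0 <= 3 / 4 * (expR theta * C `^ theta) * (p / theta) by nra.
  have lr : 3 / 4 * (expR theta * C `^ theta) * (p / theta) <=
      expR theta * C `^ theta * (2 * p / (theta * expR (11 / 12))).
    by rewrite -mulrA mulrCA ler_wpM2l.
  by rewrite lerXn2r ?nnegrE// (le_trans l0).
have [x3|x3] := ltP (p / theta) 3.
  have pt : p <= 3 * theta by move: x3; rewrite ltr_pdivrMr// => /ltW.
  exists 3%N; split=> //; first by lra.
  rewrite (_ : 3`!%N = 6%N)//; apply: exp_fact_le_moment3 => //; first by lra.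
  by apply: expR_powR_ge => //; lra.
have [n3 x_lt] :
  (3 <= Num.truncn (p / theta))%N /\ p / theta < (Num.truncn (p / theta)).+1%:R.
  by split; [rewrite truncn_ge_nat// ltW|exact: truncnS_gt].
have : (Num.truncn (p / theta))%:R <= p / theta by rewrite truncn_le// ltW.
(* The integer part of x = p / theta is now [k.+3], and the moment is one higher: x < k + 4 gives
   e^p <= e^(theta (k + 4)), while k + 3 <= x matches the base in [fact_le_exp]. *)
case: Num.truncn n3 x_lt => [|[|[|k]]]// _ x_lt x_ge.
exists k.+4; split=> //.
  by move: x_lt; rewrite ltr_pdivrMr// mulrC => /ltW/(le_trans _); apply.
apply: (@le_trans _ _ ((3 / 4 * k.+3%:R) ^+ k.+4 * expR theta ^+ k.+4)).
  apply: ler_pM; rewrite ?ler0n ?expR_ge0//; first exact: fact_le_exp.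
  rewrite -expRM_natl ler_expR.
  by move: x_lt; rewrite ltr_pdivrMr// => /ltW.
rewrite -exprMn.
have k0 : 0 <= k.+3%:R :> R by [].
have lr : 3 / 4 * k.+3%:R * expR theta <=
    3 / 4 * (expR theta * C `^ theta) * (p / theta).
  suff : k.+3%:R * expR theta <= expR theta * (C `^ theta * (p / theta)) by lra.
  rewrite mulrC ler_wpM2l ?expR_ge0//.
  by rewrite (le_trans x_ge)// ler_peMl// ltW.
have l0 : 0 <= 3 / 4 * k.+3%:R * expR theta by rewrite !mulr_ge0 ?expR_ge0.
by rewrite lerXn2r ?nnegrE// (le_trans l0).
Qed.

(** * The constant [Ctheta] *)

(** Both factors are put under one exponent, which shows that the term is at least 1 as soon as k >=
    theta^3 / (8 pi). *)
Lemma Ctheta_termE (R : realType) (theta : R) (k : nat) :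
  0 < theta -> (0 < k)%N ->
  ((2 * Num.sqrt (2 * pi)) / theta) `^ (k%:R^-1) *
    (k%:R / theta) `^ ((2 * k%:R)^-1) =
  (8 * pi / theta ^+ 3 * k%:R) `^ ((2 * k%:R)^-1).
Proof.
move=> t0 k0.
have s0 : 0 <= 2 * Num.sqrt (2 * pi) / theta.
  by rewrite divr_ge0 ?mulr_ge0 ?sqrtr_ge0// ltW.
have -> : k%:R^-1 = 2%:R * (2 * k%:R)^-1 :> R.
  by field; rewrite pnatr_eq0 -lt0n.
rewrite powRrM powR_mulrn// -powRM ?exprn_ge0 ?divr_ge0 ?(ltW t0)//.
congr (_ `^ _); rewrite expr_div_n exprMn sqr_sqrtr ?mulr_ge0 ?pi_ge0//.
by field; rewrite gt_eqF.
Qed.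

(** [sup] dominates its set only when the set is bounded, so the work is to find an upper bound. By
    m <= 2^m the base is at most (2B)^m <= (2B)^(2m), hence each term is at most 2B. *)
Lemma Ctheta_ge (R : realType) (theta : R) (k : nat) : 0 < theta -> (0 < k)%N ->
  (8 * pi / theta ^+ 3 * k%:R) `^ ((2 * k%:R)^-1) <= Ctheta theta.
Proof.
move=> t0 k0; rewrite -Ctheta_termE//; apply: ub_le_sup; last by exists k.
pose B := Num.max 1 (8 * pi / theta ^+ 3).
have B1 : 1 <= B by rewrite le_max lexx.
exists (2 * B) => _ [m m0 <-]; rewrite Ctheta_termE//.
have m0' : 0 < m%:R :> R by rewrite ltr0n.
have r0 : 0 <= (2 * m%:R)^-1 :> R by rewrite invr_ge0 mulr_ge0// ltW.
apply: (@le_trans _ _ (((2 * B) ^+ m ^+ 2) `^ (2 * m%:R)^-1)); last first.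
  rewrite -exprM -powR_mulrn ?mulr_ge0//; last by lra.
  by rewrite -powRrM natrM [m%:R * _]mulrC mulfV ?gt_eqF ?mulr_gt0// powRr1;
    lra.
have b0 : 0 <= 8 * pi / theta ^+ 3 :> R.
  by rewrite divr_ge0 ?exprn_ge0 ?mulr_ge0 ?pi_ge0 ?(ltW t0).
have Bm1 : 1 <= (2 * B) ^+ m by rewrite exprn_ege1//; lra.
apply: ge0_ler_powR; rewrite ?nnegrE//.
- by rewrite mulr_ge0.
- by rewrite !exprn_ge0// mulr_ge0//; lra.
apply: (@le_trans _ _ ((2 * B) ^+ m)); last first.
  by rewrite expr2 ler_peMl// (le_trans ler01).
rewrite exprMn mulrC ler_pM//; first by rewrite -natrX ler_nat ltnW// ltn_expl.
apply: (@le_trans _ _ B); first by rewrite le_max lexx orbT.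
by rewrite -[leLHS]expr1 ler_weXn2l.
Qed.

Lemma Ctheta_ge1 (R : realType) (theta : R) : 0 < theta -> 1 <= Ctheta theta.
Proof.
move=> t0; pose k := (Num.truncn ((8 * pi / theta ^+ 3)^-1)).+1.
apply: (le_trans _ (@Ctheta_ge R theta k t0 isT)).
have c0 : 0 < 8 * pi / theta ^+ 3 :> R.
  by rewrite divr_gt0 ?exprn_gt0 ?mulr_gt0 ?pi_gt0.
rewrite -[leLHS](powRr0 (8 * pi / theta ^+ 3 * k%:R)) ler_powR//.
  by rewrite -ler_pdivrMl// mulr1 ltW// truncnS_gt.
Qed.

(** The term k = 1 is the square root of 8 pi / theta^3, and pi >= 2. *)
Lemma Ctheta_sqr_ge (R : realType) (theta : R) : 0 < theta ->
  16 <= Ctheta theta ^+ 2 * theta ^+ 3.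
Proof.
move=> t0; have := @Ctheta_ge R theta 1 t0 isT; rewrite !mulr1.
have c0 : 0 <= 8 * pi / theta ^+ 3 :> R.
  by rewrite divr_ge0 ?exprn_ge0 ?mulr_ge0 ?pi_ge0 ?(ltW t0).
rewrite powR12_sqrt// => H.
rewrite -ler_pdivrMr ?exprn_gt0//.
apply: (@le_trans _ _ (Num.sqrt (8 * pi / theta ^+ 3) ^+ 2)).
  rewrite sqr_sqrtr// ler_wpM2r ?invr_ge0 ?exprn_ge0 ?(ltW t0)//.
  by have := pi_ge2 R; lra.
by rewrite lerXn2r ?nnegrE ?sqrtr_ge0// (le_trans _ H)// sqrtr_ge0.
Qed.

(** * From [subW_norm] to moments of the sum *)

Lemma subW_ge0 (d : measure_display) (T : measurableType d) (R : realType)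
    (P : probability T R) (theta v : R) (X : {RV P >-> R}) :
  subW theta v X -> 0 <= v.
Proof.
move=> hX; rewrite -lee_fin -hX.
apply: le_ereal_sup_tmp; eexists; first by exists 1%N.
exact: poweR_ge0.
Qed.

(** The k-th member of the supremum is the L^q norm of X divided by (k!)^(1/q), with q = theta k. *)
Lemma Lnorm_subW (d : measure_display) (T : measurableType d) (R : realType)
    (P : probability T R) (theta v : R) (X : {RV P >-> R}) (k : nat) :
  0 < theta -> subW theta v X -> (0 < k)%N ->
  ('N[P]_(theta * k%:R)%:E [EFin \o X] <=
     ((k`!)%:R `^ (theta * k%:R)^-1 * v)%:E)%E.
Proof.
move=> t0 hX k0.
have f0 : 0 < (k`!)%:R :> R by rewrite ltr0n fact_gt0.
have : ((poweR ('E_P[fun w => (`|X w| `^ (theta * k%:R))%R] * ((k`!)%:R^-1)%:E)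
         ((theta * k%:R)^-1)%R) <= v%:E)%E.
  by rewrite -hX; apply: ereal_sup_ubound; exists k.
have -> : ('E_P[fun w => (`|X w| `^ (theta * k%:R))%R] =
    \int[P]_w (`|(EFin \o X) w| `^ (theta * k%:R)))%E.
  by rewrite unlock.
have I0 : (0 <= \int[P]_w (`|(EFin \o X) w| `^ (theta * k%:R)))%E.
  by apply: integral_ge0 => w _; exact: poweR_ge0.
rewrite poweRM// poweR_EFin.
rewrite [X in (X * _ <= _)%E](_ : _ =
  'N[P]_(theta * k%:R)%:E [EFin \o X])%E; last by rewrite unlock.
set r := (theta * k%:R)^-1.
have -> : k`!%:R^-1 `^ r = (k`!%:R `^ r)^-1.
  by rewrite -[k`!%:R^-1]powR_inv1 ?(ltW f0)// -powRrM mulN1r powRN.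
by rewrite muleC lee_pdivrMl ?powR_gt0// -EFinM.
Qed.

Lemma Lnorm_sum (d : measure_display) (T : measurableType d) (R : realType)
    (mu : {measure set T -> \bar R}) (I : Type) (s : seq I) (f : I -> T -> R)
    (q : R) : 1 <= q -> (forall i, measurable_fun [set: T] (f i)) ->
  ('N[mu]_q%:E [EFin \o (fun w => (\sum_(i <- s) f i w)%R)] <=
   \sum_(i <- s) 'N[mu]_q%:E [EFin \o f i])%E.
Proof.
move=> q1 mf; elim: s => [|i s IH].
  rewrite big_nil [X in Lnorm _ _ X](_ : _ = cst 0%E).
    by rewrite Lnorm0// eqe gt_eqF// (lt_le_trans _ q1).
  by apply/funext => w /=; rewrite big_nil.
rewrite big_cons.
rewrite [X in EFin \o X](_ : _ = (f i \+ (fun w => \sum_(i <- s) f i w))%R);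
  last first.
  by apply/funext => w /=; rewrite big_cons.
apply: (le_trans (minkowski_EFin _ _ _ q1)) => //; first exact: measurable_sum.
by rewrite leeD2l.
Qed.

Lemma markov_Lnorm (d : measure_display) (T : measurableType d) (R : realType)
    (P : probability T R) (f : T -> R) (q s b : R) :
  0 < q -> 0 < s -> measurable_fun [set: T] f ->
  ('N[P]_q%:E [EFin \o f] <= b%:E)%E ->
  (P [set w | (s <= `|f w|)%R] <= ((b / s) `^ q)%:E)%E.
Proof.
move=> q0 s0 mf Nb.
have fX : f \in mfun by rewrite inE.
have b0 : 0 <= b by rewrite -lee_fin (le_trans _ Nb)// Lnorm_ge0.
have := @markov _ _ _ P (mfun_Sub fX) (fun x => x `^ q) s s0 (measurable_powR q).
move=> /(_ (fun r _ => powR_ge0 r q) (ge0_ler_powR (ltW q0))).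
have -> : 'E_P[(fun x : R => x `^ q)%R \o (fun x : R => `|x|)%R
  \o (mfun_Sub fX : T -> R)]%E =
    ('N[P]_q%:E [EFin \o f] `^ q)%E.
  by rewrite poweR_Lnorm ?gt_eqF// unlock.
move=> M; rewrite powRM ?invr_ge0 ?(ltW s0)//.
have sq0 : 0 < s `^ q by rewrite powR_gt0.
rewrite -[s^-1]powR_inv1 ?(ltW s0)// powRAC powR_inv1 ?powR_ge0//.
rewrite EFinM muleC lee_pdivlMl// (le_trans M)// -poweR_EFin.
apply: gt0_ler_poweR; rewrite ?(ltW q0)//.
- by rewrite in_itv/= leey Lnorm_ge0.
- by rewrite in_itv/= leey lee_fin b0.
Qed.

Lemma probability_abs_sum_ge (d : measure_display) (T : measurableType d)
    (R : realType) (P : probability T R) (theta : R) (n : nat)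
    (X : 'I_n -> {RV P >-> R}) (v : 'I_n -> R) (k : nat) (s : R) :
  0 < theta -> (forall i, subW theta (v i) (X i)) ->
  (0 < k)%N -> 1 <= theta * k%:R -> 0 < s ->
  (P [set w | (s <= `|\sum_(i < n) X i w|)%R] <=
     ((k`!)%:R * ((\sum_(i < n) v i) / s) `^ (theta * k%:R))%:E)%E.
Proof.
move=> t0 hX k0 q1 s0.
have q0 : 0 < theta * k%:R by rewrite (lt_le_trans _ q1).
apply: (le_trans (@markov_Lnorm _ _ _ P _ (theta * k%:R) s
  ((k`!)%:R `^ (theta * k%:R)^-1 * \sum_(i < n) v i) q0 s0 _ _)).
- exact: measurable_sum.
- apply: (le_trans (@Lnorm_sum _ _ _ _ _ _ (fun i => X i : T -> R) _ q1 _)) =>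
  //.
  rewrite mulr_sumr -sumEFin; apply: lee_sum => i _.
  exact: Lnorm_subW.
- have V0 :
  0 <= \sum_(i < n) v i by rewrite sumr_ge0// => i _; exact: subW_ge0 (hX i).
  rewrite -mulrA powRM ?powR_ge0 ?divr_ge0 ?(ltW s0)// -powRrM mulVf ?gt_eqF//.
  by rewrite powRr1.
Qed.

(** * Tails of the sum *)

(** Some k has theta k >= 1, and Minkowski's inequality then makes the norm of the sum vanish. This
    settles the degenerate case left out by [subW_sum_tail]. *)
Lemma subW_sum_ae0 (d : measure_display) (T : measurableType d)
    (R : realType) (P : probability T R) (theta : R) (n : nat)
    (X : 'I_n -> {RV P >-> R}) (v : 'I_n -> R) :
  0 < theta -> (forall i, subW theta (v i) (X i)) -> \sum_(i < n) v i = 0 ->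
  P [set w | 0 < `|\sum_(i < n) X i w|] = 0%E.
Proof.
move=> t0 hX V0.
pose k := (Num.truncn theta^-1).+1.
have q1 : 1 <= theta * k%:R.
  by rewrite -ler_pdivrMl// mulr1 ltW// truncnS_gt.
have mS : measurable_fun [set: T] (fun w => \sum_(i < n) X i w).
  exact: measurable_sum.
have N0 : ('N[P]_(theta * k%:R)%:E [EFin
  \o (fun w => (\sum_(i < n) X i w)%R)])%E = 0%E.
  apply/eqP; rewrite eq_le Lnorm_ge0 andbT.
  apply: (le_trans (@Lnorm_sum _ _ _ _ _ _ (fun i => X i : T -> R) _ q1 _)) =>
    //.
  apply: (@le_trans _ _
    (\sum_(i < n) ((k`!)%:R `^ (theta * k%:R)^-1 * v i)%:E)%E).
    by apply: lee_sum => i _; exact: Lnorm_subW.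
  by rewrite sumEFin -mulr_sumr V0 mulr0.
have q0 : (0 < (theta * k%:R)%:E)%E by rewrite lte_fin (lt_le_trans _ q1).
have mSE : measurable_fun [set: T] (EFin \o (fun w => \sum_(i < n) X i w)).
  exact/measurable_EFinP.
have [A [mA A0 sA]] := Lnorm_eq0_eq0 mSE q0 N0.
apply/eqP; rewrite eq_le measure_ge0 andbT -A0.
apply: le_measure; rewrite ?inE//.
  rewrite (_ : mkset _ = [set: T]
    `&` (fun w => `|\sum_(i < n) X i w|) @^-1` `]0, +oo[).
    have mN : measurable_fun [set: T] (fun w => `|\sum_(i < n) X i w|).
      exact: measurableT_comp.
    exact: mN.
  by apply/seteqP; split=> w /=; rewrite in_itv/= andbT// => -[].
move=> w /= Sw; apply: sA => /= /(_ I) [S0]; by rewrite S0 normr0 ltxx in Sw.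
Qed.

Lemma subW_sum_tail (d : measure_display) (T : measurableType d)
    (R : realType) (P : probability T R) (theta : R) (n : nat)
    (X : 'I_n -> {RV P >-> R}) (v : 'I_n -> R) (p s : R) :
  0 < theta -> (forall i, subW theta (v i) (X i)) -> 0 < \sum_(i < n) v i ->
  1 <= p ->
  expR 1 * (\sum_(i < n) v i) * Ctheta theta
    * (2 * p / (theta * expR (11 / 12))) `^ theta^-1 <= s ->
  (P [set w | (s <= `|\sum_(i < n) X i w|)%R] <= (expR (- p))%:E)%E.
Proof.
move=> t0 hX; set V := \sum_(i < n) v i => V0 p1.
have C1 := Ctheta_ge1 t0.
have [k [k0 tk H]] := exists_moment t0 C1 (fun=> Ctheta_sqr_ge t0) p1.
set x := 2 * p / _ in H *.
have x0 : 0 < x.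
  by rewrite /x divr_gt0 ?mulr_gt0 ?expR_gt0//; lra.
set y := expR theta * Ctheta theta `^ theta * x in H.
set s' := expR 1 * V * _ * _ => ss'.
have C0 : 0 < Ctheta theta by lra.
clearbody x.
have s'0 : 0 < s' by rewrite /s' !mulr_gt0 ?expR_gt0 ?powR_gt0.
have s0 : 0 < s by exact: lt_le_trans ss'.
have y0 : 0 < y by rewrite /y !mulr_gt0 ?expR_gt0 ?powR_gt0.
(* So y = (s' / V)^theta, and at s' the moment bound k! (V / s')^(theta k) becomes k! / y^k, which
   the choice of k makes at most e^(-p). *)
have Ey : V / s' = y^-1 `^ theta^-1.
  rewrite -[y^-1]powR_inv1 ?(ltW y0)// powRAC powR_inv1 ?powR_ge0//.
  have th0 : theta != 0 by rewrite gt_eqF.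
  have e0 := expR_ge0 theta.
  rewrite /y !powRM ?mulr_ge0 ?powR_ge0 ?(ltW x0)// -expRM -powRrM mulfV//.
  rewrite powRr1 /s'; last by lra.
  by field; rewrite !gt_eqF ?powR_gt0 ?expR_gt0//; lra.
apply: (le_trans (probability_abs_sum_ge t0 hX k0 tk s0)).
rewrite lee_fin.
apply: (@le_trans _ _ ((k`!)%:R * (V / s') `^ (theta * k%:R))).
  rewrite ler_wpM2l// ge0_ler_powR ?nnegrE ?divr_ge0 ?(ltW V0) ?(ltW s0)
    ?(ltW s'0)//.
    by rewrite (le_trans _ tk).
  by rewrite ler_wpM2l ?(ltW V0)// lef_pV2.
rewrite Ey -powRrM mulrA mulVf ?gt_eqF// mul1r powR_mulrn ?invr_ge0 ?(ltW y0)//.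
rewrite exprVn ler_pdivrMr ?exprn_gt0//.
by rewrite expRN ler_pdivlMl ?expR_gt0// mulrC.
Qed.

(** * First moments, for small [t] *)

(** After normalisation by the sum M, each ratio m_i / M lies in [0, 1], where raising to the power
    t <= 1 does not decrease; the ratios add up to 1. *)
Lemma sum_le_powR_sum (R : realType) (I : finType) (m : I -> R) (t : R) :
  0 < t -> t <= 1 -> (forall i, 0 <= m i) ->
  \sum_i m i <= (\sum_i m i `^ t) `^ t^-1.
Proof.
move=> t0 t1 m0; set M := \sum_i m i.
have M0 : 0 <= M by apply: sumr_ge0.
have [->|Mn0] := eqVneq M 0; first exact: powR_ge0.
have Mgt : 0 < M by rewrite lt_neqAle eq_sym Mn0.
suff : M `^ t <= \sum_i m i `^ t.
  move=> H; rewrite -[leLHS]powRr1// -(mulfV (lt0r_neq0 t0)) powRrM.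
  by rewrite ge0_ler_powR ?nnegrE ?invr_ge0 ?powR_ge0 ?(ltW t0)//
    (le_trans _ H) ?powR_ge0.
rewrite -[leLHS]mul1r -ler_pdivlMr ?powR_gt0// -(mulfV Mn0) {1}/M !mulr_suml.
apply: ler_sum => i _.
rewrite -[(M `^ t)^-1]powR_inv1 ?powR_ge0// powRAC powR_inv1// -powRM
  ?invr_ge0//.
have [->|mi0] := eqVneq (m i) 0; first by rewrite mul0r powR_ge0.
have mi : 0 < m i by rewrite lt_neqAle eq_sym mi0 m0.
apply: ger1_powR => //; rewrite divr_gt0//= ler_pdivrMr// mul1r.
by rewrite /M (bigD1 i)//= lerDl sumr_ge0.
Qed.

(** On a probability space L^q lies in L^1 for q >= 1. Finiteness matters because [fine] would send
    an infinite mean to 0. *)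
Lemma subW_expectation_fin_num (d : measure_display) (T : measurableType d)
    (R : realType) (P : probability T R) (theta v : R) (X : {RV P >-> R}) :
  0 < theta -> subW theta v X ->
  'E_P[fun w => (`|X w|)%R]%E \is a fin_num.
Proof.
move=> t0 hX.
pose k := (Num.truncn theta^-1).+1.
have q1 : 1 <= theta * k%:R.
  by rewrite -ler_pdivrMl// mulr1 ltW// truncnS_gt.
have XL : (X : T -> R) \in Lfun P (theta * k%:R)%:E.
  rewrite inE; apply/andP; split; rewrite inE//=.
  by rewrite /finite_norm (le_lt_trans (@Lnorm_subW _ _ _ _ _ _ _ k t0 hX _))// ltry.
apply: expectation_fin_num.
apply: Lfun_norm.
apply: (Lfun_subset _ _ _ _ XL) => //; rewrite ?lee_fin//.
exact: fin_num_measure.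
Qed.

Lemma probability_abs_sum_ge_mean (d : measure_display) (T : measurableType d)
    (R : realType) (P : probability T R) (n : nat) (X : 'I_n -> {RV P >-> R})
    (s : R) :
  (forall i, 'E_P[fun w => (`|X i w|)%R]%E \is a fin_num) -> 0 < s ->
  expR 1 * \sum_(i < n) fine 'E_P[fun w => (`|X i w|)%R] <= s ->
  (P [set w | (s <= `|\sum_(i < n) X i w|)%R] <= (expR (- 1))%:E)%E.
Proof.
move=> fX s0 hs; set m := \sum_(i < n) _ in hs.
have m0 : 0 <= m.
  by apply: sumr_ge0 => i _; rewrite fine_ge0// expectation_ge0.
apply: (le_trans (@markov_Lnorm _ _ _ P _ 1 s m ltr01 s0 _ _)).
- exact: measurable_sum.
- apply: (le_trans (@Lnorm_sum _ _ _ _ _ _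
  (fun i => X i : T -> R) _ (lexx 1) _)) => //.
  rewrite /m -sumEFin; apply: lee_sum => i _.
  by rewrite fineK// Lnorm1 unlock.
rewrite powRr1 ?divr_ge0 ?(ltW s0)// lee_fin ler_pdivrMr// expRN.
by rewrite ler_pdivlMl ?expR_gt0.
Qed.

(** * The three bounds *)

Theorem theorem2 (d : measure_display) (T : measurableType d) (R : realType)
    (P : probability T R) (theta : R) (htheta : 0 < theta)
    (n : nat) (hn : (0 < n)%N)
    (X : 'I_n -> {RV P >-> R}) (v : 'I_n -> R)
    (hind : mutually_independent X)
    (hX : forall i : 'I_n, subW theta (v i) (X i)) :
  let e : R := expR 1 in
  let C : R := Ctheta theta in
  let V : R := \sum_(i < n) v i in
  let vbar : R := n%:R^-1 * \sum_(i < n) v i in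
  [/\ (forall t : R,
         e * V * C * (2^-1 * theta * expR (11 / 12)) `^ (- theta^-1) <= t ->
         (P [set w | (t <= `|\sum_(i < n) X i w|)%R ]
            <= (expR (- (theta * expR (11 / 12) * t `^ theta
                         / (2 * (e * V * C) `^ theta))))%:E)%E),
      (forall alpha : R, 0 < alpha ->
         1 - alpha \in `]1 - expR (- 1), 1] ->
         ((1 - alpha)%:E <=
            P [set w | (`|n%:R^-1 * \sum_(i < n) X i w| <=
                 e * vbar * 2 `^ theta^-1 * C
                 * (ln alpha^-1 / (theta * expR (11 / 12))) `^ theta^-1)%R ])%E)
    & (* Excluded case: if every v i is 0, then all the X i vanish almost surely,
         the threshold below is 0, and the probability is 1 > exp (- t). *)
      (0 < V -> forall t : R, 0 < t ->
         (P [set w | (e * (\sum_(i < n)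
                             fine 'E_P[fun w' => (`|X i w'|)%R] `^ t) `^ t^-1
                      + e * V * 2 `^ theta^-1 * C
                        * (t / (theta * expR (11 / 12))) `^ theta^-1
                      <= `|\sum_(i < n) X i w|)%R ]
            <= (expR (- t))%:E)%E)].
Proof.
move=> e C V vbar.
have V0 : 0 <= V by rewrite sumr_ge0// => i _; exact: subW_ge0 (hX i).
have C0 : 0 < C by have := Ctheta_ge1 htheta; rewrite -/C; lra.
have e0 : 0 < e by exact: expR_gt0.
have E0 : 0 < theta * expR (11 / 12) by rewrite mulr_gt0 ?expR_gt0.
have mS : measurable_fun [set: T] (fun w => `|\sum_(i < n) X i w|).
  by apply: measurableT_comp => //; exact: measurable_sum.
have mle s : measurable [set w | s <= `|\sum_(i < n) X i w|].
  rewrite (_ : mkset _ = [set: T]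
    `&` (fun w => `|\sum_(i < n) X i w|) @^-1` `[s, +oo[).
    exact: mS.
  by apply/seteqP; split=> w /=; rewrite in_itv/= andbT// => -[].
have mlt s : measurable [set w | s < `|\sum_(i < n) X i w|].
  rewrite (_ : mkset _ = [set: T]
    `&` (fun w => `|\sum_(i < n) X i w|) @^-1` `]s, +oo[).
    exact: mS.
  by apply/seteqP; split=> w /=; rewrite in_itv/= andbT// => -[].
have rateE p :
  0 <= p -> 2 `^ theta^-1 * (p / (theta * expR (11 / 12))) `^ theta^-1
    = (2 * p / (theta * expR (11 / 12))) `^ theta^-1.
  by move=> p0; rewrite -powRM ?divr_ge0 ?(ltW E0)// mulrA.
split.
- move=> t ht.
  (* When V = 0 the exponent divides by 0; the inverse of 0 being 0, the claimed bound is 1. *)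
  have [V0'|Vn0] := eqVneq V 0.
    rewrite V0' mulr0 mul0r powR0 ?gt_eqF// mulr0 invr0 mulr0 oppr0 expR0.
    exact: probability_le1.
  have Vgt : 0 < V by rewrite lt_neqAle eq_sym Vn0.
  have K0 : 0 < e * V * C by rewrite !mulr_gt0.
  have A0 : 0 < 2^-1 * theta * expR (11 / 12) by rewrite -mulrA mulr_gt0.
  have t0 : 0 < t by rewrite (lt_le_trans _ ht)// mulr_gt0// powR_gt0.
  have KK : 0 < (e * V * C) `^ theta by rewrite powR_gt0.
  apply: (@subW_sum_tail _ _ _ _ theta _ _ v) => //.
    (* Here p is the exponent in the claim, and p >= 1 is the assumed lower bound on t raised to the
       power theta. *)
    rewrite ler_pdivlMr ?mulr_gt0// mul1r.
    have : (e * V * C * (2^-1 * theta * expR (11 / 12)) `^ - theta^-1) `^ theta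
        <= t `^ theta.
      by rewrite ge0_ler_powR ?nnegrE ?(ltW htheta) ?(ltW t0)// mulr_ge0
        ?(ltW K0) ?powR_ge0.
    rewrite powRM ?powR_ge0 ?(ltW K0)// -powRrM mulNr mulVf ?gt_eqF//.
    rewrite powR_inv1 ?(ltW A0)// ler_pdivrMr//; lra.
  (* With this p, 2 p / (theta e^(11/12)) = (t / (e V C))^theta, so the threshold of [subW_sum_tail]
     is t itself. *)
  rewrite -/V -/C -/e [X in X `^ theta^-1](_ : _ = (t / (e * V * C)) `^ theta);
    last first.
    rewrite [in RHS]powRM ?invr_ge0 ?(ltW t0) ?(ltW K0)//.
    rewrite -[(e * V * C)^-1]powR_inv1 ?(ltW K0)// powRAC powR_inv1 ?(ltW KK)//.
    by field; rewrite !gt_eqF ?expR_gt0.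
  rewrite -powRrM mulfV ?gt_eqF// powRr1 ?divr_ge0 ?(ltW t0) ?(ltW K0)//.
  by rewrite mulrC divfK ?gt_eqF.
- move=> alpha a0; rewrite in_itv/= => /andP[a1 _].
  have {}a1 : alpha < expR (- 1) by lra.
  have p1 : 1 < ln alpha^-1.
    by rewrite lnV ?posrE// ltrNr -[ltRHS]expRK ltr_ln ?posrE ?expR_gt0.
  have Ea : expR (- ln alpha^-1) = alpha by rewrite lnV ?posrE// opprK lnK
    ?posrE.
  have n0 : 0 < n%:R :> R by rewrite ltr0n.
  set thr := e * vbar * _ * _ * _.
  have thrE : thr = n%:R^-1 * (e * V * C *
      (2 * ln alpha^-1 / (theta * expR (11 / 12))) `^ theta^-1).
    rewrite -rateE; last by lra.
    by rewrite /thr /vbar -/V; ring.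
  (* Passing to the complement, with p = log (1 / alpha): the strict event there lies inside the
     non-strict one of [subW_sum_tail]. *)
  rewrite (_ : mkset _ = ~` [set w | n%:R * thr < `|\sum_(i < n) X i w|]);
    last first.
    apply/seteqP; split=> w /=; rewrite normrM (@ger0_norm _ n%:R^-1) ?invr_ge0
      ?ler0n//.
      by rewrite ler_pdivrMl// => /le_gtF ->.
    by move=> /negP; rewrite -leNgt ler_pdivrMl.
  rewrite probability_setC// EFinB; apply: leeB => //.
  rewrite thrE mulVKf ?gt_eqF//.
  have [V0'|Vn0] := eqVneq V 0.
    rewrite V0' mulr0 !mul0r (@subW_sum_ae0 _ _ _ _ _ _ _ v htheta)//.
    by rewrite lee_fin ltW.
  have Vgt : 0 < V by rewrite lt_neqAle eq_sym Vn0.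
  rewrite -[X in (_ <= X%:E)%E]Ea.
  apply: le_trans (@subW_sum_tail
    _ _ _ P theta n X v _ _ htheta hX Vgt (ltW p1) (lexx _)).
  by apply: le_measure; rewrite ?inE// => w /= /ltW.

- move=> Vgt t t0.
  set thr := e * _ + _.
  have m0 i : 0 <= fine 'E_P[fun w' => (`|X i w'|)%R].
    by rewrite fine_ge0// expectation_ge0.
  have sec : e * V * 2 `^ theta^-1 * C
      * (t / (theta * expR (11 / 12))) `^ theta^-1 =
    e * V * C * (2 * t / (theta * expR (11 / 12))) `^ theta^-1.
    by rewrite -rateE ?(ltW t0)//; ring.
  have sec0 : 0 < e * V * C * (2 * t / (theta * expR (11 / 12))) `^ theta^-1.
    by rewrite !mulr_gt0// powR_gt0// divr_gt0// mulr_gt0.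
  have fst0 :
    0 <= (\sum_(i < n) fine 'E_P[fun w' => (`|X i w'|)%R] `^ t) `^ t^-1.
    exact: powR_ge0.
  (* For t <= 1 the first summand of the threshold already dominates e times the sum of the means,
     and e^(-1) <= e^(-t). For t > 1 the second summand is the threshold of [subW_sum_tail] at p =
     t. *)
  have [t1|t1] := leP t 1.
    apply: (@le_trans _ _ (expR (- 1))%:E); last by rewrite lee_fin ler_expR;
      lra.
    apply: probability_abs_sum_ge_mean.
    + by move=> i; exact: subW_expectation_fin_num htheta (hX i).
    + by rewrite /thr sec ltr_wpDl// mulr_ge0// ltW.
    + rewrite /thr sec ler_wpDr ?(ltW sec0)// ler_wpM2l ?(ltW e0)//.
      exact: sum_le_powR_sum.
  apply: (@subW_sum_tail _ _ _ _ theta _ _ v) => //; first exact: ltW.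
  by rewrite -/V -/C -/e -sec /thr lerDr mulr_ge0// ltW.
Qed.
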